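(* If $N$ is an odd perfect number, then $$\frac{99}{37}\,\omega(N) - \frac{187}{37} \leq \Omega(N).$$
   Context: A positive integer is perfect if the sum of its positive integer divisors equals twice itself. $\omega(N)$ denotes the number of distinct prime factors of $N$, and $\Omega(N)$ denotes the total number of prime factors of $N$ counted with multiplicity. *)

(* Defs.v *)
From mathcomp Require Import all_boot all_order all_algebra.

Set Implicit Arguments.
Unset Strict Implicit.
Unset Printing Implicit Defensive.

(* Positivity is explicit because [divisors 0] is a default value. *)
Definition perfect (n : nat) : bool :=
  (0 < n) && (\sum_(d <- divisors n) d == 2 * n).

Definition little_omega (n : nat) : nat := size (primes n).

Definition big_omega (n : nat) : nat := \sum_(p <- primes n) logn p n.

(* Main.v *)
Require Import Defs.
From mathcomp Require Import all_boot all_order all_algebra.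
From mathcomp Require Import zify ring lra.

Set Implicit Arguments.
Unset Strict Implicit.
Unset Printing Implicit Defensive.

(**
Write f(q) = q^2 + q + 1, so that f(q) = sigma(q^2) for a prime q.

The prime factors of N other than 3 are of three kinds: those of exponent
exactly 2, which form a list S; those of even exponent at least 4; and at most
one of odd exponent, because sigma(p^k) is even for odd k while
sigma(N) = 2N is not divisible by 4.  In terms of
37 Omega - 99 omega, a prime of exponent v contributes 37 v - 99.  This is
at least 49 for v at least 4 and equals -25 for v = 2, so the point is that N
cannot consist mostly of primes of S.  The reason is that the product of the
f(q), q in S, divides N: the primes of S need other primes to absorb the prime
factors of the f(q).  Such a factor is 3 or is 1 mod 3, and 3 divides f(q)
exactly when q is 1 mod 3.  Hence the exponent of 3 in N is at least the number
of q in S with q = 1 mod 3, which improves -25 to +12 for those, and primes of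
S that are 2 mod 3 absorb nothing.

The count is organised as a transfer of charges.  Every prime r <> 3 of N pays,
to each q in S, [base] for each time that it divides f(q), plus possibly a
[bonus].  The amounts are the dual solution of a linear program, and
they satisfy the following.
- Every q in S receives at least 25 if q = 2 mod 3 and at least 21 if
  q = 1 mod 3 ([received_2mod3], [received_1mod3]).
- A prime r of exponent v in N pays at most 8 v + 17 if it is hit, that is
  equal to some f(y) with y in S, and at most 9 v + 12 otherwise ([paid_le]).
  For v = 2 this is at most 33 = 12 + 21, for even v >= 4 at most 37 v - 99,
  and for odd v at most 37 v - 11.
Summing over all primes ([local_balance], [omega_balance]) gives
99 omega <= 37 Omega + 187; the constant is 99 for the prime 3 plus 88 for the
prime of odd exponent.

The arithmetic lies in how two values f(x), f(y) can share a prime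
r.  Such an r divides x - y or x + y + 1, so for odd x, y below 2r one has
x = y, x + y + 1 = r or x + y + 1 = 3r ([dvd_cyclo3_odd_pair]).  Residues mod 3
decide which, and equality of r or 3r with f(y) would make x = y^2, which is not
prime.  Consequently bonuses at one prime rarely meet ([claim_pair]), and
a prime at which a bonus other than the 17 of a hit is paid is not hit.  One
overlap is possible: r can be the larger factor of f(a) = r l while 3r = f(b).
Then l carries the bonus of a instead, and meets no other bonus there: since
l <= a < 2l ([claim_located]), a + q + 1 = l is excluded for every q.

Finally a q = 2 mod 3 whose f(q) has three prime factors gets no bonus, and
receives 25 only if one of the factors is not hit.  This holds because
f(x) = f(a) f(b) f(c) is impossible for odd primes a, b, c that are 2 mod 3 and
have f(a), f(b), f(c) prime
([cyclo3_neq_prime_triple]): factor x - w in the Eisenstein integers.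
*)

(** * The sum of divisors *)

Definition sigma (n : nat) : nat := \sum_(d <- divisors n) d.

Lemma sigma_coprime m n :
  0 < m -> 0 < n -> coprime m n -> sigma (m * n) = sigma m * sigma n.
Proof.
move=> m_gt0 n_gt0 co_mn; have mn_gt0 : 0 < m * n by rewrite muln_gt0 m_gt0.
have -> : sigma (m * n) =
    \sum_(x <- [seq d * e | d <- divisors m, e <- divisors n]) x.
  apply: perm_big; apply: uniq_perm; first exact: divisors_uniq.
    apply: allpairs_uniq; rewrite ?divisors_uniq // => -[d e] [d' e'].
    have gcdE d0 e0 : d0 \in divisors m -> e0 \in divisors n ->
        gcdn m (d0 * e0) = d0.
      rewrite -!dvdn_divisors // => dm en.
      rewrite Gauss_gcdl; first by apply/gcdn_idPr.
      exact: coprime_dvdr en co_mn.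
    move=> /allpairsP[[d1 e1] [/= d1m e1n [-> ->]]].
    move=> /allpairsP[[d2 e2] [/= d2m e2n [-> ->]]] eq_de.
    have eq_d : d1 = d2 by rewrite -(gcdE d1 e1) // eq_de gcdE.
    move: d1m; rewrite -eq_d in eq_de *; rewrite -dvdn_divisors // => d1m.
    have d1_gt0 : 0 < d1 by exact: dvdn_gt0 d1m.
    by move/eqP: eq_de; rewrite eqn_pmul2l // => /eqP->.
  move=> x; rewrite -dvdn_divisors //; apply/idP/allpairsP => /=.
    move=> x_dv; exists (gcdn x m, gcdn x n); rewrite /= -!dvdn_divisors //.
    rewrite !dvdn_gcdr; split=> //; apply/eqP; rewrite eqn_dvd; apply/andP; split.
      rewrite muln_gcdr !muln_gcdl !dvdn_gcd x_dv.
      rewrite (dvdn_mulr x (dvdnn x)) (dvdn_mull m (dvdnn x)).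
      by rewrite (dvdn_mulr n (dvdnn x)).
    rewrite Gauss_dvd ?dvdn_gcdl //.
    by apply: coprime_dvdl (dvdn_gcdr _ _) (coprime_dvdr (dvdn_gcdr _ _) co_mn).
  by case=> -[d e] [/=]; rewrite -!dvdn_divisors // => dm en ->; apply: dvdn_mul.
rewrite big_allpairs_dep /= /sigma big_distrl /=; apply: eq_bigr => d _.
by rewrite big_distrr.
Qed.

Lemma sigma_pfactor p k : prime p -> sigma (p ^ k) = \sum_(0 <= i < k.+1) p ^ i.
Proof.
move=> p_pr; rewrite /sigma -(big_map (expn p) xpredT id).
apply: perm_big; apply: uniq_perm; first exact: divisors_uniq.
  rewrite map_inj_uniq ?iota_uniq //.
  by apply: expnI; apply: prime_gt1.
move=> d; rewrite -dvdn_divisors ?expn_gt0 ?prime_gt0 //.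
apply/(dvdn_pfactor _ _ p_pr)/mapP => [[i le_ik ->]|[i]].
  by exists i; rewrite // mem_index_iota ltnS.
by rewrite mem_index_iota ltnS => le_ik ->; exists i.
Qed.

Lemma sigma_primes n : 0 < n ->
  sigma n = \prod_(p <- primes n) sigma (p ^ logn p n).
Proof.
move=> n_gt0; rewrite [in LHS](prod_prime_decomp n_gt0) prime_decompE big_map /=.
set e := fun p => logn p n.
rewrite -/(e _) (eq_bigr (fun p => p ^ e p)) //.
rewrite [RHS](eq_bigr (fun p => sigma (p ^ e p))) //.
have: all prime (primes n) by apply/allP => p; rewrite mem_primes => /andP[].
elim: (primes n) (primes_uniq n) => [|p ps IH] /=.
  by rewrite !big_nil /sigma big_seq1.
case/andP=> p_ps ps_uniq /andP[p_pr ps_pr]; rewrite !big_cons -IH //.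
have ps_gt0 : 0 < \prod_(q <- ps) q ^ e q.
  rewrite big_seq prodn_cond_gt0 // => q q_ps.
  by rewrite expn_gt0 prime_gt0 // (allP ps_pr).
apply: sigma_coprime => //; first by rewrite expn_gt0 prime_gt0.
rewrite coprimeXl // big_seq; apply: (big_ind (coprime p)).
- by rewrite coprimen1.
- by move=> a b pa pb; rewrite coprimeMr pa.
move=> q q_ps; rewrite coprimeXr // prime_coprime // dvdn_prime2 ?(allP ps_pr _ q_ps) //.
by apply: contraNneq p_ps => ->.
Qed.

Lemma perfect_sigma n : perfect n -> 0 < n /\ sigma n = 2 * n.
Proof. by case/andP=> n_gt0 /eqP. Qed.

Lemma even_sigma_pfactor p k : odd p -> prime p -> odd k -> 2 %| sigma (p ^ k).
Proof.
move=> p_odd p_pr k_odd; rewrite sigma_pfactor // dvdn2.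
suff -> : odd (\sum_(0 <= i < k.+1) p ^ i) = odd k.+1 by rewrite /= k_odd.
elim: k.+1 => [|m IH]; first by rewrite big_geq.
by rewrite big_nat_recr //= oddD IH oddX p_odd orbT addbT.
Qed.

(** Two such primes would make 4 divide sigma(n) = 2n. *)
Lemma odd_exponent_unique n p q : odd n -> perfect n ->
  p \in primes n -> q \in primes n -> odd (logn p n) -> odd (logn q n) -> p = q.
Proof.
move=> n_odd /perfect_sigma[n_gt0 sig_n] p_n q_n vp_odd vq_odd.
have [//|neq_pq] := eqVneq p q.
have dv2 r : r \in primes n -> odd (logn r n) -> 2 %| sigma (r ^ logn r n).
  rewrite mem_primes n_gt0 /= => /andP[r_pr r_n] vr_odd.
  by apply: even_sigma_pfactor => //; apply: dvdn_odd n_odd.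
have : 4 %| sigma n.
  rewrite (sigma_primes n_gt0) (bigD1_seq p) ?primes_uniq //=.
  rewrite (big_rem q) //= eq_sym neq_pq mulnA.
  by rewrite dvdn_mulr // (dvdn_mul (dv2 p _ _) (dv2 q _ _)).
by rewrite sig_n -[4]/(2 * 2) dvdn_pmul2l // dvdn2 n_odd.
Qed.

(** * Common prime factors of values of q^2 + q + 1 *)

(** The third cyclotomic polynomial; [cyclo3 q = sigma (q ^ 2)] for prime [q]. *)
Definition cyclo3 (q : nat) : nat := q * q + q + 1.

Lemma cyclo3_odd x : odd (cyclo3 x).
Proof. by rewrite /cyclo3 addn1 /= oddD oddM andbb addbb. Qed.

Lemma dvd_cyclo3_odd r x : r %| cyclo3 x -> odd r.
Proof. by move/dvdn_odd; apply; apply: cyclo3_odd. Qed.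

(** The difference of the two values is [(y - x) * (x + y + 1)]: modulo [r]
the polynomial has the two roots [x] and [-1 - x]. *)
Lemma dvd_cyclo3_diff_or_sum r x y :
    prime r -> r %| cyclo3 x -> r %| cyclo3 y -> x <= y ->
  r %| y - x \/ r %| x + y + 1.
Proof.
move=> r_pr rx ry le_xy; apply/orP; rewrite -Euclid_dvdM //.
suff -> : (y - x) * (x + y + 1) = cyclo3 y - cyclo3 x by apply: dvdn_sub.
rewrite /cyclo3; nia.
Qed.

(** Since [x ^ 3 = 1] modulo [r], a prime [r = 2] mod 3 would give
[x = x ^ r = x ^ 2], hence [x = 1] and [r = 3]. *)
Lemma dvd_cyclo3_mod3 r x : prime r -> r %| cyclo3 x -> r = 3 \/ r %% 3 = 1.
Proof.
move=> r_pr r_sx; have r_gt1 := prime_gt1 r_pr.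
have x3 : x ^ 3 = 1 %[mod r].
  apply/eqP; case: (posnP x) r_sx => [->|x_gt0 r_sx].
    by rewrite /cyclo3 dvdn1 => /eqP r1; rewrite r1 in r_pr.
  rewrite eqn_mod_dvd ?expn_gt0 ?x_gt0 //.
  suff -> : x ^ 3 - 1 = (x - 1) * cyclo3 x by rewrite dvdn_mull.
  by rewrite /cyclo3 !expnS expn0; nia.
have x3k k : x ^ (3 * k) = 1 %[mod r].
  by rewrite expnM -modnXm x3 modnXm exp1n.
have := fermat_little x r_pr.
rewrite {1}[in x ^ r](divn_eq r 3) expnD [r %/ 3 * 3]mulnC -modnMm x3k modnMm mul1n.
have : r %% 3 < 3 by rewrite ltn_mod.
have [r3|] := eqVneq (r %% 3) 0.
  move=> _ _; left; apply/eqP; rewrite eq_sym -dvdn_prime2 //.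
  by rewrite /dvdn r3.
have [|] := eqVneq (r %% 3) 1; first by right.
move=> n1 n0 lt3; have -> : r %% 3 = 2 by lia.
move=> x2; left.
have co_xr : coprime r x.
  rewrite prime_coprime //; apply/negP => r_x.
  have : r %| 1 by rewrite -(@dvdn_addr (x * x + x)) // dvdn_add // dvdn_mulr.
  by rewrite dvdn1; lia.
have x_gt0 : 0 < x by case: (x) r_sx => //; rewrite /cyclo3 dvdn1; lia.
have r_x1 : r %| x - 1.
  have : r %| x ^ 2 - x by rewrite -eqn_mod_dvd ?x2 // expnS expn1; nia.
  have -> : x ^ 2 - x = x * (x - 1) by rewrite -mulnn mulnBr muln1.
  by rewrite Gauss_dvdr.
have : r %| 3.
  have e : cyclo3 x = (x - 1) * (x + 2) + 3.
    by rewrite /cyclo3; case: (x) x_gt0 => // x' _; rewrite subn1 /=; ring.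
  by move: r_sx; rewrite e dvdn_addr // dvdn_mulr.
by rewrite dvdn_prime2 // => /eqP.
Qed.

Lemma cyclo3_2mod3 x : x %% 3 = 2 -> ~~ (3 %| cyclo3 x).
Proof. by rewrite /dvdn /cyclo3 => x2; rewrite (divn_eq x 3) x2; lia. Qed.

Lemma cyclo3_1mod3 x : x %% 3 = 1 -> exists2 m, cyclo3 x = 3 * m & m %% 3 = 1.
Proof.
move=> x1; exists ((x %/ 3) * (x %/ 3) * 3 + 3 * (x %/ 3) + 1).
  by rewrite /cyclo3 {1 2 3}(divn_eq x 3) x1; nia.
by lia.
Qed.

Lemma odd_multiple d m : d %| m -> odd m -> m < 4 * d -> m = d \/ m = 3 * d.
Proof.
case/dvdnP=> k ->; rewrite oddM => /andP[odd_k _] lt4; have {lt4} : k < 4 by nia.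
by case: k odd_k => [|[|[|[|]]]] //= _; [rewrite mul1n; left | right].
Qed.

(** Parity makes the list short: [x - y] is an even multiple of the odd [r]
of absolute value below [2 * r], and [x + y + 1] is an odd multiple below [4 * r]. *)
Lemma dvd_cyclo3_odd_pair r x y : prime r -> odd x -> odd y ->
    r %| cyclo3 x -> r %| cyclo3 y -> x < 2 * r -> y < 2 * r ->
  [\/ x = y, x + y + 1 = r | x + y + 1 = 3 * r].
Proof.
move=> r_pr; have r_gt0 := prime_gt0 r_pr.
wlog le_xy : x y / x <= y => [wlog_xy|] x_odd y_odd rx ry ltx lty.
  case: (leqP x y) => [/wlog_xy|/ltnW/wlog_xy]; first exact.
  rewrite (addnC y x) => /(_ y_odd x_odd ry rx lty ltx)[->|e|e];
    by [constructor 1|constructor 2|constructor 3].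
have [/dvdnP[k def_k]|r_xy] := dvd_cyclo3_diff_or_sum r_pr rx ry le_xy.
  have : k < 2 by nia.
  have odd_r := dvd_cyclo3_odd rx.
  have : ~~ odd (y - x) by rewrite oddB // x_odd y_odd.
  rewrite def_k oddM odd_r andbT.
  by case: k def_k => [|[|]] //= def_k _ _; constructor 1; lia.
have [||e|e] := odd_multiple r_xy; last 2 first.
- by constructor 2.
- by constructor 3.
- by rewrite addn1 /= oddD x_odd y_odd.
by lia.
Qed.

(** * No value is a product of three prime values *)

Section Eisenstein.
Import Order.TTheory GRing.Theory Num.Theory.
Local Open Scope ring_scope.

(** With [w] a primitive cube root of unity, [u ^ 2 - u * t + t ^ 2] is the norm
of [u + t * w] and [p] is the norm of [b - w].  The lemma says that a prime
of norm [p], either [b - w] or its conjugate up to sign [-1 - b - w], divides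
[u + t * w]; the quotient is [u' + t' * w]. *)
Lemma eisenstein_factor (p : nat) (b u t k : int) :
    prime p -> p%:Z = b * b + b + 1 ->
    u * u - u * t + t * t = p%:Z * k ->
  exists b' u' t' : int, [/\ b' = b \/ b' = -1 - b,
    u = b' * u' + t', t = (b' + 1) * t' - u' & u' * u' - u' * t' + t' * t' = k].
Proof.
move=> p_pr def_p norm_ut.
have p_neq0 : p%:Z != 0 by have := prime_gt0 p_pr; lia.
have [b' [def_b' [t' e]]] :
    exists b', (b' = b \/ b' = -1 - b) /\ exists t', u + t * b' = p%:Z * t'.
  (* Modulo p the norm splits into these two linear factors. *)
  have : (p %| `|((u + t * b) * (u + t * (-1 - b)))%R|)%N.
    have -> : (u + t * b) * (u + t * (-1 - b)) = p%:Z * (k - t * t).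
      by rewrite [RHS]mulrBr -norm_ut def_p; ring.
    by rewrite abszM dvdn_mulr.
  rewrite abszM Euclid_dvdM // => /orP[] dvd_p.
    exists b; split; first by left.
    have /dvdzP[t' ->] : (p%:Z %| u + t * b)%Z by [].
    by exists t'; rewrite mulrC.
  exists (-1 - b); split; first by right.
  have /dvdzP[t' ->] : (p%:Z %| u + t * (-1 - b))%Z by [].
  by exists t'; rewrite mulrC.
have def_p' : p%:Z = b' * b' + b' + 1.
  by rewrite def_p; case: def_b' => ->; ring.
have def_u : u = b' * (t' * (b' + 1) - t) + t'.
  have -> : u = p%:Z * t' - t * b' by rewrite -e; ring.
  by rewrite def_p'; ring.
have def_t : t = (b' + 1) * t' - (t' * (b' + 1) - t) by ring.
exists b', (t' * (b' + 1) - t), t'; split=> //.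
apply: (mulfI p_neq0); rewrite -norm_ut def_p'.
set u' := t' * _ - t in def_u def_t *.
by rewrite def_u [t]def_t; ring.
Qed.

Lemma eisenstein_unit (u t : int) : u * u - u * t + t * t = 1 ->
  [\/ t = 0 /\ (u = 1 \/ u = -1), u = 0 /\ (t = 1 \/ t = -1)
    | u = t /\ (t = 1 \/ t = -1)].
Proof.
move=> norm1.
have e4 : (2 * u - t) * (2 * u - t) + 3 * (t * t) = 4.
  by transitivity (4 * (u * u - u * t + t * t)); [ring | rewrite norm1].
have t_small : -1 <= t <= 1 by nia.
have [t0|[t1|t1]] : t = 0 \/ t = 1 \/ t = -1 by lia.
- by constructor 1; split=> //; nia.
- have [->|->] : u = 0 \/ u = 1 by nia.
    by constructor 2; lia.
  by constructor 3; lia.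
have [->|->] : u = 0 \/ u = -1 by nia.
  by constructor 2; lia.
by constructor 3; lia.
Qed.

(** [(a - w) * (b - w) * (c - w) = triple_re a b c - triple_im a b c * w]. *)
Definition triple_re (a b c : int) := a * b * c - a - b - c - 1.
Definition triple_im (a b c : int) := a * b + b * c + c * a + a + b + c.

(** Some multiple of [(a - w) * (b - w) * (c - w)] by a unit has [w]-coordinate
[1] or [-1], as [x - w] does. *)
Definition unit_coef (a b c : int) : Prop :=
  let P := triple_re a b c in let Q := triple_im a b c in
  [\/ P = 1 \/ P = -1, Q = 1 \/ Q = -1 | P + Q = 1 \/ P + Q = -1].

Lemma unit_coef_conj a b c :
  unit_coef a b c -> unit_coef (-1 - a) (-1 - b) (-1 - c).
Proof.
rewrite /unit_coef.
have -> : triple_im (-1 - a) (-1 - b) (-1 - c) = triple_im a b c.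
  by rewrite /triple_im; ring.
have -> : triple_re (-1 - a) (-1 - b) (-1 - c) = - (triple_re a b c + triple_im a b c).
  by rewrite /triple_re /triple_im; ring.
move: (triple_re _ _ _) (triple_im _ _ _) => P Q [e|e|e].
- by constructor 3; lia.
- by constructor 2.
by constructor 1; lia.
Qed.

Lemma unit_coef_rot a b c : unit_coef a b c -> unit_coef b c a.
Proof.
rewrite /unit_coef.
have -> : triple_im b c a = triple_im a b c by rewrite /triple_im; ring.
by have -> : triple_re b c a = triple_re a b c by rewrite /triple_re; ring.
Qed.

(** Substituting [i + 5], [j + 5], [k + 5] leaves polynomials whose
coefficients are all positive. *)
Lemma unit_coef_pos (a b c : nat) : (5 <= a)%N -> (5 <= b)%N -> (5 <= c)%N ->
  ~ unit_coef a b c.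
Proof.
move=> a5 b5 c5; have [i ->] : exists i, a = (i + 5)%N by exists (a - 5)%N; lia.
have [j ->] : exists j, b = (j + 5)%N by exists (b - 5)%N; lia.
have [k ->] : exists k, c = (k + 5)%N by exists (c - 5)%N; lia.
have ij : (0 <= (i * j))%N by []. have jk : (0 <= (j * k))%N by [].
have ik : (0 <= (i * k))%N by []. have ijk : (0 <= (i * j * k))%N by [].
rewrite /unit_coef /triple_re /triple_im; case; lia.
Qed.

(** Only the case [triple_im = 1] or [-1] is not settled by size.  It says
[b * c = a * (b + c + 1)], impossible as then [a] is [b] or [c], or
[b * c = a * (b + c + 1) + 2], impossible modulo 3. *)
Lemma unit_coef_neg (a b c : nat) : prime a -> prime b -> prime c ->
    (a %% 3 = 2)%N -> (b %% 3 = 2)%N -> (c %% 3 = 2)%N ->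
  ~ unit_coef (-1 - a%:Z) b c.
Proof.
move=> a_pr b_pr c_pr a2 b2 c2.
have bc1 : (1 < b * c)%N by have := prime_gt1 b_pr; have := prime_gt1 c_pr; nia.
rewrite /unit_coef /=; case=> [e|e|e].
- have : triple_re (-1 - a%:Z) b c = - ((a + 1) * (b * c - 1) + b + c + 1)%N%:Z.
    by rewrite /triple_re; lia.
  by lia.
- have [e0|e2] : (b * c = a * (b + c + 1) \/ b * c = a * (b + c + 1) + 2)%N.
    by move: e; rewrite /triple_im; lia.
    have : (a %| b * c)%N by rewrite e0 dvdn_mulr.
    rewrite Euclid_dvdM // !dvdn_prime2 // => /orP[]/eqP e1.
      by move/eqP: e0; rewrite -e1 eqn_pmul2l ?prime_gt0 //; lia.
    by move/eqP: e0; rewrite -e1 mulnC eqn_pmul2l ?prime_gt0 //; lia.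
  have thirds d : (d %% 3 = 2)%N -> exists i, (d = 3 * i + 2)%N.
    by exists (d %/ 3)%N; lia.
  move: (thirds a a2) (thirds b b2) (thirds c c2) e2 => [i ->] [j ->] [k ->].
  lia.
have : triple_re (-1 - a%:Z) b c + triple_im (-1 - a%:Z) b c
    = - (a * (b * c + b + c) + b + c + 1)%N%:Z.
  by rewrite /triple_re /triple_im; lia.
by lia.
Qed.

(** [x - w] would be a unit times the product of three factors [d - w] or
[-1 - d - w], [d] ranging over [a], [b], [c]; compare the coordinates on [w].
Conjugating and rotating, at most one factor is of the second kind. *)
Lemma cyclo3_neq_prime_triple (a b c x : nat) : prime a -> prime b -> prime c ->
    (a %% 3 = 2)%N -> (b %% 3 = 2)%N -> (c %% 3 = 2)%N ->
    odd a -> odd b -> odd c ->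
    prime (cyclo3 a) -> prime (cyclo3 b) -> prime (cyclo3 c) ->
  cyclo3 x <> (cyclo3 a * cyclo3 b * cyclo3 c)%N.
Proof.
move=> a_pr b_pr c_pr a2 b2 c2 a_odd b_odd c_odd sa_pr sb_pr sc_pr sx.
have ge5 d : prime d -> (d %% 3 = 2)%N -> odd d -> (5 <= d)%N.
  by move=> /prime_gt1; clear; lia.
have sE d : (cyclo3 d)%:Z = d%:Z * d%:Z + d%:Z + 1.
  by clear; rewrite /cyclo3; lia.
have norm_x : x%:Z * x%:Z - x%:Z * (-1) + (-1) * (-1)
    = (cyclo3 a)%:Z * (cyclo3 b * cyclo3 c)%N%:Z.
  by rewrite -[RHS]PoszM mulnA -sx sE; ring.
have [a' [u1 [t1 [a'E xE eq1 norm1]]]] := eisenstein_factor sa_pr (sE a) norm_x.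
rewrite PoszM in norm1.
have [b' [u2 [t2 [b'E u1E t1E norm2]]]] := eisenstein_factor sb_pr (sE b) norm1.
rewrite -[(cyclo3 c)%:Z]mulr1 in norm2.
have [c' [u3 [t3 [c'E u2E t2E norm3]]]] := eisenstein_factor sc_pr (sE c) norm2.
have coefE : -1 = (triple_re a' b' c' + triple_im a' b' c') * t3 - triple_im a' b' c' * u3.
  rewrite eq1 u1E t1E u2E t2E /triple_re /triple_im; ring.
have unit_abc : unit_coef a' b' c'.
  rewrite /unit_coef; move: (triple_re _ _ _) (triple_im _ _ _) coefE => P Q coefE.
  have [[t30 u3E]|[u30 t3E]|[u3t3 t3E]] := eisenstein_unit norm3.
  - by constructor 2; case: u3E => u3E; move: coefE; rewrite t30 u3E; clear; lia.
  - by constructor 3; case: t3E => t3E; move: coefE; rewrite u30 t3E; clear; lia.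
  by constructor 1; case: t3E => t3E; move: coefE; rewrite u3t3 t3E; clear; lia.
have conjK (d : int) : -1 - (-1 - d) = d by ring.
move: unit_abc; case: a'E => ->; case: b'E => ->; case: c'E => ->.
- by apply: unit_coef_pos; apply: ge5.
- by do 2 move/unit_coef_rot; apply: unit_coef_neg.
- by move/unit_coef_rot; apply: unit_coef_neg.
- by move/unit_coef_conj; rewrite !conjK; apply: unit_coef_neg.
- by apply: unit_coef_neg.
- by move/unit_coef_conj; rewrite !conjK => /unit_coef_rot; apply: unit_coef_neg.
- by move/unit_coef_conj; rewrite !conjK; do 2 move/unit_coef_rot; apply: unit_coef_neg.
by move/unit_coef_conj; rewrite !conjK; apply: unit_coef_pos; apply: ge5.
Qed.

End Eisenstein.

Lemma cyclo3_not_square q m : 0 < q -> cyclo3 q <> m * m.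
Proof.
rewrite /cyclo3 => q_gt0 e; have lt_qm : q < m by clear -e; nia.
have : m < q + 1 by clear -e q_gt0; nia.
by lia.
Qed.

(** * The transfer of charges *)

Section Discharging.

Variable S : seq nat.
Hypothesis S_good : {in S, forall q, [/\ prime q, odd q & q <> 3]}.

Let S_prime : {in S, forall q, prime q}. Proof. by move=> q /S_good[]. Qed.
Let S_odd : {in S, forall q, odd q}. Proof. by move=> q /S_good[]. Qed.
Let S_neq3 : {in S, forall q, q <> 3}. Proof. by move=> q /S_good[]. Qed.

Lemma S_mod3 q : q \in S -> q %% 3 = 1 \/ q %% 3 = 2.
Proof.
move=> qS; have : ~~ (3 %| q).
  by rewrite dvdn_prime2 ?(S_prime qS) //; apply/eqP => e; apply: (S_neq3 qS).
by rewrite /dvdn; lia.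
Qed.

Lemma S_ge5 q : q \in S -> 5 <= q.
Proof.
move=> qS; have := prime_gt1 (S_prime qS); have := S_odd qS; have := S_neq3 qS.
by move: q {qS}; do 5 case=> //.
Qed.

Definition hit (r : nat) : bool := r \in [seq cyclo3 y | y <- S].

Definition third_hit (r : nat) : bool := 3 * r \in [seq cyclo3 b | b <- S].

(** A hit prime saves capacity for the bonus of 17 that it also pays. *)
Definition base (r : nat) : nat := if hit r then 8 else 9.

(** The rules, with [l] prime:
- [cyclo3 q = r]: 17;
- [cyclo3 q = r * l]: 8 to the larger factor, or to the smaller one when the
  larger one is already a third of some [cyclo3 b];
- [cyclo3 q = 3 * r]: 12;
- [cyclo3 q = 3 * r * l] with [l <= r]: 4. *)
Definition bonus (q r : nat) : nat :=
  if q %% 3 == 2 then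
    if cyclo3 q == r then 17 else
    let l := cyclo3 q %/ r in
    if [&& prime l, cyclo3 q == r * l
         & if l < r then ~~ third_hit r else third_hit l] then 8 else 0
  else
    if cyclo3 q == 3 * r then 12 else
    let l := cyclo3 q %/ (3 * r) in
    if [&& prime l, cyclo3 q == 3 * r * l & l <= r] then 4 else 0.

Variant claim (q r : nat) : nat -> Prop :=
| ClaimHit of q %% 3 = 2 & cyclo3 q = r : claim q r 17
| ClaimLarger l of q %% 3 = 2 & prime l & cyclo3 q = r * l & l < r
    & ~~ third_hit r : claim q r 8
| ClaimSmaller l of q %% 3 = 2 & prime l & cyclo3 q = r * l & r <= l
    & third_hit l : claim q r 8
| ClaimThird of q %% 3 = 1 & cyclo3 q = 3 * r : claim q r 12
| ClaimThirdLarger l of q %% 3 = 1 & prime l & cyclo3 q = 3 * r * l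
    & l <= r : claim q r 4.

Lemma bonusP q r : q \in S -> 0 < bonus q r -> claim q r (bonus q r).
Proof.
move=> qS; rewrite /bonus; have [q2|q2] := eqVneq.
  have [/eqP sq|_] := ifPn; first by constructor.
  have [/and3P[l_pr /eqP sq]|//] := ifP.
  have [lt_lr|le_rl] := ltnP => cond _; first exact: ClaimLarger sq _ _.
  exact: ClaimSmaller sq _ _.
have q1 : q %% 3 = 1 by case: (S_mod3 qS) => // e; rewrite e in q2.
have [/eqP sq|_] := ifPn; first by constructor.
by have [/and3P[l_pr /eqP sq le_lr] _|//] := ifP; apply: ClaimThirdLarger sq _.
Qed.

Lemma claim_dvd q r w : claim q r w -> r %| cyclo3 q.
Proof.
case=> [_ ->|l _ _ -> _ _|l _ _ -> _ _|_ ->|l _ _ -> _].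
- exact: dvdnn.
- exact: dvdn_mulr.
- exact: dvdn_mulr.
- exact: dvdn_mull.
by rewrite dvdn_mulr ?dvdn_mull.
Qed.

(** What a claim says about the position of [q] relative to [r], in a form to
which [dvd_cyclo3_odd_pair] applies. *)
Variant located (q r : nat) : nat -> Prop :=
| LocHit of q %% 3 = 2 & cyclo3 q = r : located q r 17
| LocLarger of q %% 3 = 2 & q < r & ~~ third_hit r : located q r 8
| LocSmaller of q %% 3 = 2 & r <= q & q < 2 * r : located q r 8
| LocThird of q %% 3 = 1 & cyclo3 q = 3 * r : located q r 12
| LocThirdLarger of q %% 3 = 1 & q < 2 * r : located q r 4.

(** Only the bound [q < 2 * r] for a bonus moved to the smaller factor needs an
argument: the larger factor [l] satisfies [cyclo3 b = 3 * l] and, by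
[dvd_cyclo3_odd_pair], [q + b + 1 = l].  Then [b <= q + 1] by the first equation,
so [l <= 2 * q + 2], whereas [r * l = cyclo3 q]. *)
Lemma claim_located q r w : q \in S -> prime r -> claim q r w -> located q r w.
Proof.
move=> qS r_pr; have r_gt1 := prime_gt1 r_pr.
case=> [q2 sq|l q2 l_pr sq lt_lr nc|l q2 l_pr sq le_rl /mapP[b bS /esym sb]|
  q1 sq|l q1 l_pr sq le_lr]; try by constructor.
- by constructor=> //; move: sq lt_lr; rewrite /cyclo3; clear; nia.
- have b5 := S_ge5 bS.
  have b1 : b %% 3 = 1.
    by case: (S_mod3 bS) => // /cyclo3_2mod3; rewrite sb dvdn_mulr.
  have lt_ql : q < l by move: sq le_rl r_gt1; rewrite /cyclo3; clear; nia.
  have lt_b2l : b < 2 * l by move: sb b5; rewrite /cyclo3; clear; nia.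
  have l_sq : l %| cyclo3 q by rewrite sq dvdn_mull.
  have l_sb : l %| cyclo3 b by rewrite sb dvdn_mull.
  have l1 : l %% 3 = 1.
    case: (dvd_cyclo3_mod3 l_pr l_sq) => // l3; move: l_sq; rewrite l3.
    by rewrite (negPf (cyclo3_2mod3 q2)).
  have lt_q2l : q < 2 * l by lia.
  have [e|e|e] := dvd_cyclo3_odd_pair l_pr (S_odd qS) (S_odd bS) l_sq l_sb lt_q2l lt_b2l.
  + by rewrite e b1 in q2.
  + have le_bq : b <= q + 1 by move: sb b5; rewrite -e /cyclo3; clear; nia.
    have le_l : r * l <= r * (2 * q + 2).
      by rewrite leq_mul2l; apply/orP; right; move: e le_bq; clear; lia.
    have le_rr : r * r <= r * l by rewrite leq_mul2l le_rl orbT.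
    apply: LocSmaller => //; first by move: sq le_rr r_gt1; rewrite /cyclo3; clear; nia.
    by move: sq le_l; rewrite /cyclo3; clear; nia.
  by exfalso; lia.
by constructor=> //; move: sq le_lr r_gt1; rewrite /cyclo3; clear; nia.
Qed.

Lemma located_lt q r w : q \in S -> prime r -> located q r w -> q < 2 * r.
Proof.
move=> qS r_pr; have r_gt0 := prime_gt0 r_pr; have q5 := S_ge5 qS.
case=> [_ e|_ lt_qr _|//|_ e|//]; last by move: e q5; rewrite /cyclo3; clear; nia.
  by rewrite -e /cyclo3; move: q5; clear; nia.
by move: lt_qr r_gt0; clear; lia.
Qed.

Lemma claim_mod3 q r w : q \in S -> prime r -> r <> 3 -> claim q r w -> r %% 3 = 1.
Proof. by move=> qS r_pr r3 /claim_dvd/(dvd_cyclo3_mod3 r_pr)[]. Qed.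

Lemma prime_not_square p y : prime p -> p <> y * y.
Proof.
move=> p_pr def_p; have := prime_gt1 p_pr.
have : y %| p by rewrite def_p dvdn_mulr.
by case/primeP: p_pr => _ /[apply] /orP[]/eqP; nia.
Qed.

(** Two claims of 8 and 4, or of 4 and 4, add up to at most 12, and
the value of [q + q' + 1] prevents a third claim. *)
Definition compatible (q q' r w w' : nat) : Prop :=
  [\/ [/\ w = 4, w' = 4 & q + q' + 1 = 3 * r],
      [/\ w = 8, w' = 4 & q + q' + 1 = r]
    | [/\ w = 4, w' = 8 & q + q' + 1 = r]].

(** By [dvd_cyclo3_odd_pair], [q + q' + 1] is [r] or [3 * r], and which of them
is fixed by the residues of [q] and [q'] mod 3; two residues 2 exclude both.
If in addition [cyclo3 q] equals [r] or [3 * r], whichever is the value of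
[q + q' + 1], then [q' = q ^ 2].  The choice between the larger and the smaller
factor excludes the rest: one claim of 8 needs that [r] is not a third of
some [cyclo3 b], the other has [q >= r]. *)
Lemma claim_pair q q' r w w' :
    q \in S -> q' \in S -> q <> q' -> prime r -> r <> 3 ->
    claim q r w -> claim q' r w' -> compatible q q' r w w'.
Proof.
move=> qS q'S neq_qq' r_pr r3 clq clq'; have r1 := claim_mod3 qS r_pr r3 clq.
have [rq rq'] := (claim_dvd clq, claim_dvd clq').
have cq := claim_located qS r_pr clq; have cq' := claim_located q'S r_pr clq'.
have lt_q := located_lt qS r_pr cq; have lt_q' := located_lt q'S r_pr cq'.
have nsq y : q <> y * y := @prime_not_square q y (S_prime qS).
have nsq' y : q' <> y * y := @prime_not_square q' y (S_prime q'S).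
have no_third_hit b : b \in S -> cyclo3 b = 3 * r -> ~~ third_hit r -> False.
  by move=> bS sb /mapP[]; exists b.
have [//|e|e] :=
    dvd_cyclo3_odd_pair r_pr (S_odd qS) (S_odd q'S) rq rq' lt_q lt_q'.
  case: cq cq' => [q2 sq|q2 ltq nc|q2 geq ltq|q1 sq|q1 _]
      [q2' sq'|q2' ltq' nc'|q2' geq' ltq'|q1' sq'|q1' _];
    try by [exfalso; clear -e r1 q2 q2'; lia | exfalso; clear -e r1 q1 q1'; lia
           | exfalso; clear -e geq; lia | exfalso; clear -e geq'; lia].
  - by case: (nsq' q); move: sq e; rewrite /cyclo3; clear; lia.
  - by case: (nsq' q); move: sq e; rewrite /cyclo3; clear; lia.
  - by case: (no_third_hit q').
  - by constructor 2.
  - by case: (nsq q'); move: sq' e; rewrite /cyclo3; clear; lia.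
  - by case: (no_third_hit q).
  - by case: (nsq q'); move: sq' e; rewrite /cyclo3; clear; lia.
  by constructor 3.
case: cq cq' => [q2 sq|q2 ltq nc|q2 geq ltq|q1 sq|q1 _]
    [q2' sq'|q2' ltq' nc'|q2' geq' ltq'|q1' sq'|q1' _];
  try by [exfalso; clear -e r1 q2 q2'; lia | exfalso; clear -e r1 q2 q1'; lia
         | exfalso; clear -e r1 q1 q2'; lia].
- by case: (nsq' q); move: sq e; rewrite /cyclo3; clear; lia.
- by case: (nsq' q); move: sq e; rewrite /cyclo3; clear; lia.
- by case: (nsq q'); move: sq' e; rewrite /cyclo3; clear; lia.
by constructor 1.
Qed.

Lemma hit_mod3 y r : y \in S -> prime r -> r <> 3 -> cyclo3 y = r -> y %% 3 = 2.
Proof.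
move=> yS r_pr r3 sy.
have [y1|//] := S_mod3 yS; have [m sm _] := cyclo3_1mod3 y1.
have : 3 %| r by rewrite -sy sm dvdn_mulr.
by rewrite dvdn_prime2 // => /eqP e; case: r3.
Qed.

(** If [cyclo3 y = r], then [y] itself claims 17 at [r], which is compatible with
no other claim. *)
Lemma claimed_unhit q r : q \in S -> prime r -> r <> 3 -> claim q r (bonus q r) ->
  bonus q r <> 17 -> ~~ hit r.
Proof.
move=> qS r_pr r3 cq n17; apply/mapP => -[y yS /esym sy].
have y2 := hit_mod3 yS r_pr r3 sy.
have neq : y <> q by move=> e; apply: n17; rewrite /bonus -e sy y2 !eqxx.
by case: (claim_pair yS qS neq r_pr r3 (ClaimHit y2 sy) cq) => -[].
Qed.

(** At most two claims meet, and then they add up to at most 12; a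
single claim exceeds 12 only when it is the 17 of a hit. *)
Lemma bonus_total r : uniq S -> prime r -> r <> 3 ->
  \sum_(q <- S) bonus q r <= if hit r then 17 else 12.
Proof.
move=> S_uniq r_pr r3.
rewrite (bigID (fun q => 0 < bonus q r)) /= [X in _ + X]big1 ?addn0; last first.
  by move=> q; rewrite -leqNgt leqn0 => /eqP.
rewrite -big_filter.
have claimF q : q \in [seq q <- S | 0 < bonus q r] -> q \in S /\ claim q r (bonus q r).
  by rewrite mem_filter => /andP[b_gt0 qS]; split=> //; apply: bonusP.
have uniqF : uniq [seq q <- S | 0 < bonus q r] by rewrite filter_uniq.
case: [seq q <- S | _] claimF uniqF => [|q F] claimF.
  by rewrite big_nil.
have [qS cq] := claimF q (mem_head _ _).
case: F claimF => [|q' F] claimF.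
  rewrite big_seq1 => _.
  case: cq => [q2 sq|l *|l *|*|l *]; try by case: ifP.
  by rewrite (_ : hit r) //; apply/mapP; exists q.
have [q'S cq'] : q' \in S /\ claim q' r (bonus q' r).
  by apply: claimF; rewrite !inE eqxx orbT.
rewrite !cons_uniq !inE !negb_or => /and3P[/andP[/eqP neq_qq' qF] q'F uF].
have comp := claim_pair qS q'S neq_qq' r_pr r3 cq cq'.
case: F claimF qF q'F uF => [|q2 F] claimF qF q'F _.
  rewrite !big_cons big_nil; case: comp => -[-> -> _]; by case: ifP.
have [q2S cq2] : q2 \in S /\ claim q2 r (bonus q2 r).
  by apply: claimF; rewrite !inE eqxx !orbT.
move: qF q'F; rewrite !inE !negb_or => /andP[/eqP neq_qq2 _] /andP[/eqP neq_q'q2 _].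
have := claim_pair qS q2S neq_qq2 r_pr r3 cq cq2.
have := claim_pair q'S q2S neq_q'q2 r_pr r3 cq' cq2.
move: comp neq_qq' neq_qq2 neq_q'q2; clear=> comp nqq' nqq2 nq'q2.
by case: comp => -[? ? ?] [] [? ? ?] [] [? ? ?]; lia.
Qed.

Variable N : nat.
Hypothesis N_gt0 : 0 < N.
Hypothesis cyclo3_dvd_N : {in S, forall q, cyclo3 q %| N}.

Definition not3_primes : seq nat := [seq r <- primes N | r != 3].

Lemma mem_not3_primes r : r \in not3_primes = [&& prime r, r %| N & r != 3].
Proof. by rewrite mem_filter mem_primes N_gt0 /= andbC andbA. Qed.

Definition weight (m : nat) : nat := \sum_(r <- not3_primes) base r * logn r m.

Lemma weightM m1 m2 : 0 < m1 -> 0 < m2 -> weight (m1 * m2) = weight m1 + weight m2.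
Proof.
move=> m1_gt0 m2_gt0; rewrite /weight -big_split /=; apply: eq_bigr => r _.
by rewrite lognM // mulnDr.
Qed.

Lemma weight_prime p : p \in not3_primes -> weight p = base p.
Proof.
move=> pR; rewrite /weight (bigD1_seq p) ?filter_uniq ?primes_uniq //=.
move: (pR); rewrite mem_not3_primes => /and3P[p_pr _ _].
rewrite logn_prime // eqxx muln1 big_seq_cond big1 ?addn0 // => r.
rewrite mem_not3_primes => /andP[/and3P[r_pr _ _] neq].
by rewrite logn_prime // (negPf neq) muln0.
Qed.

Lemma weight3 : weight 3 = 0.
Proof.
rewrite /weight big_seq big1 // => r; rewrite mem_not3_primes => /and3P[r_pr _ r3].
by rewrite logn_prime // (negPf r3) muln0.
Qed.

Lemma base_ge8 r : 8 <= base r.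
Proof. by rewrite /base; case: ifP. Qed.

(** [p] is the least prime factor, so that peeling twice yields the factors in
increasing order. *)
Lemma split_prime n : n %| N -> ~~ (3 %| n) -> 1 < n ->
  exists p m, [/\ n = p * m, p \in not3_primes /\ prime p,
    [/\ m %| N, ~~ (3 %| m) & 0 < m], weight n = base p + weight m
    & forall d, 1 < d -> d %| m -> p <= d].
Proof.
move=> nN n3 n_gt1; have p_pr := pdiv_prime n_gt1.
have [m def_n] := dvdnP (pdiv_dvd n); rewrite mulnC in def_n.
have m_gt0 : 0 < m by move: def_n n_gt1; case: m => //; rewrite muln0 => ->.
have pR : pdiv n \in not3_primes.
  rewrite mem_not3_primes p_pr (dvdn_trans (pdiv_dvd n) nN) /=.
  by apply: contraNneq n3 => <-; apply: pdiv_dvd.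
exists (pdiv n), m; split=> //.
- split=> //; first by rewrite (dvdn_trans _ nN) // def_n dvdn_mull.
  by apply: contra n3 => m3; rewrite def_n dvdn_mull.
- by rewrite {1}def_n weightM ?pdiv_gt0 // weight_prime.
by move=> d d_gt1 d_m; apply: pdiv_min_dvd; rewrite // def_n dvdn_mull.
Qed.

Definition received (q : nat) : nat :=
  \sum_(r <- not3_primes) (base r * logn r (cyclo3 q) + bonus q r).

Lemma received_bonus q r : r \in not3_primes ->
  weight (cyclo3 q) + bonus q r <= received q.
Proof.
move=> rR; rewrite /received big_split /= leq_add2l.
by rewrite (bigD1_seq r) ?filter_uniq ?primes_uniq //= leq_addr.
Qed.

Lemma received_weight q : weight (cyclo3 q) <= received q.
Proof. by rewrite /received big_split leq_addr. Qed.

Lemma base_claimed q r : q \in S -> prime r -> r <> 3 -> claim q r (bonus q r) ->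
  bonus q r <> 17 -> base r = 9.
Proof.
move=> qS r_pr r3 cq n17.
by rewrite /base (negPf (claimed_unhit qS r_pr r3 cq n17)).
Qed.

Lemma not3_neq r : r \in not3_primes -> r <> 3.
Proof. by rewrite mem_not3_primes => /and3P[_ _ /eqP]. Qed.

(** Three factors give [3 * 8 >= 21]; with one or two, the claimed prime is not
hit, and the totals are [9 + 12] and at least [(9 + 4) + 8]. *)
Lemma received_1mod3 q : q \in S -> q %% 3 = 1 -> 21 <= received q.
Proof.
move=> qS q1; have [n sq n1] := cyclo3_1mod3 q1.
have nN : n %| N by apply: dvdn_trans (cyclo3_dvd_N qS); rewrite sq dvdn_mull.
have n3 : ~~ (3 %| n) by rewrite /dvdn n1.
have n_gt1 : 1 < n by move: sq (S_ge5 qS); rewrite /cyclo3; clear; nia.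
have [p [m [def_n [pR p_pr] [mN m3 m_gt0] wn p_min]]] := split_prime nN n3 n_gt1.
have wsq : weight (cyclo3 q) = weight n.
  by rewrite sq weightM ?weight3 // ltnW.
have p3 := not3_neq pR; have p_gt0 := prime_gt0 p_pr.
have [m1|m_gt1|m0] := ltngtP m 1; first by case: (m) m_gt0 m1.
  have [p2 [m2 [def_m [p2R p2_pr] [m2N m23 m2_gt0] wm p2_min]]] := split_prime mN m3 m_gt1.
  have [m1|m2_gt1|m21] := ltngtP m2 1; first by case: (m2) m2_gt0 m1.
    have [p3' [m3' [_ _ _ wm2 _]]] := split_prime m2N m23 m2_gt1.
    have := received_weight q; rewrite wsq wn wm wm2.
    by move: (base_ge8 p) (base_ge8 p2) (base_ge8 p3'); clear; lia.
  have le_pp2 : p <= p2 by apply: p_min; rewrite ?prime_gt1 // def_m dvdn_mulr.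
  have sq2 : cyclo3 q = 3 * p2 * p by rewrite sq def_n def_m m21; ring.
  have b4 : bonus q p2 = 4.
    rewrite /bonus q1 /= [cyclo3 q == _](_ : _ = false); last first.
      by apply/eqP; rewrite sq2; move: (prime_gt1 p_pr) (prime_gt0 p2_pr); clear; nia.
    by rewrite sq2 mulKn ?muln_gt0 ?prime_gt0 // p_pr eqxx le_pp2.
  have base2 : base p2 = 9.
    apply: (@base_claimed q) => //; first exact: not3_neq.
      by apply: bonusP => //; rewrite b4.
    by rewrite b4.
  have := received_bonus q p2R; rewrite b4 wsq wn wm base2.
  by move: (base_ge8 p); clear; lia.
have sqp : cyclo3 q = 3 * p by rewrite sq def_n m0 muln1.
have b12 : bonus q p = 12 by rewrite /bonus q1 sqp eqxx.
have base_p : base p = 9.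
  apply: (@base_claimed q) => //; [by apply: bonusP; rewrite ?b12|by rewrite b12].
by have := received_bonus q pR; rewrite b12 wsq wn base_p; lia.
Qed.

(** One factor gives at least [8 + 17], two give at least [(9 + 8) + 8], three
give at least [9 + 8 + 8] because not all are hit, and four give [4 * 8]. *)
Lemma received_2mod3 q : q \in S -> q %% 3 = 2 -> 25 <= received q.
Proof.
move=> qS q2; have sq_gt1 : 1 < cyclo3 q by have := S_ge5 qS; rewrite /cyclo3; lia.
have [p [m [def_s [pR p_pr] [mN m3 m_gt0] ws p_min]]] :=
  split_prime (cyclo3_dvd_N qS) (cyclo3_2mod3 q2) sq_gt1.
have base_p := base_ge8 p.
have [m1|m_gt1|m1] := ltngtP m 1; first by case: (m) m_gt0 m1.
  have [p2 [m2 [def_m [p2R p2_pr] [m2N m23 m2_gt0] wm p2_min]]] := split_prime mN m3 m_gt1.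
  have base_p2 := base_ge8 p2.
  have [m1|m2_gt1|m21] := ltngtP m2 1; first by case: (m2) m2_gt0 m1.
    have [p3 [m4 [def_m2 [p3R p3_pr] [m4N m43 m4_gt0] wm2 _]]] := split_prime m2N m23 m2_gt1.
    have base_p3 := base_ge8 p3.
    have := received_weight q; rewrite ws wm wm2.
    have [m1|m4_gt1|m41] := ltngtP m4 1; first by case: (m4) m4_gt0 m1.
      have [p4 [m5 [_ _ _ wm4 _]]] := split_prime m4N m43 m4_gt1.
      by move: (base_ge8 p4) base_p base_p2 base_p3; rewrite wm4; clear; lia.
    have not_all_hit : ~ [/\ hit p, hit p2 & hit p3].
      case=> /mapP[y1 y1S /esym sy1] /mapP[y2 y2S /esym sy2] /mapP[y3 y3S /esym sy3].
      have mod_y y r : y \in S -> r \in not3_primes -> prime r ->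
          cyclo3 y = r -> y %% 3 = 2.
        by move=> yS rR r_pr; apply: hit_mod3 => //; apply: not3_neq.
      apply: (@cyclo3_neq_prime_triple y1 y2 y3 q); rewrite ?sy1 ?sy2 ?sy3 //;
        try solve [exact: S_prime | exact: S_odd].
      - exact: mod_y sy1.
      - exact: mod_y sy2.
      - exact: mod_y sy3.
      by rewrite def_s def_m def_m2 m41; ring.
    move: not_all_hit; clear; rewrite /base.
    by case: (hit p); case: (hit p2); case: (hit p3) => // nh; try lia; case: nh.
  have le_pp2 : p <= p2 by apply: p_min; rewrite ?prime_gt1 // def_m dvdn_mulr.
  have sq2 : cyclo3 q = p * p2 by rewrite def_s def_m m21 muln1.
  have lt_pp2 : p < p2.
    rewrite ltn_neqAle le_pp2 andbT; apply/eqP => e; move: sq2; rewrite e.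
    by apply: cyclo3_not_square; have := S_ge5 qS; case: (q).
  have bonus_p r l : cyclo3 q = r * l -> prime r -> prime l ->
      (if l < r then ~~ third_hit r else third_hit l) -> bonus q r = 8.
    move=> sqr r_pr l_pr cond; rewrite /bonus q2 /= [cyclo3 q == r](_ : _ = false).
      by rewrite sqr mulKn ?prime_gt0 // l_pr eqxx cond.
    by apply/eqP; rewrite sqr; move: (prime_gt1 l_pr) (prime_gt0 r_pr); clear; nia.
  have base_9 r : r \in not3_primes -> prime r -> bonus q r = 8 -> base r = 9.
    move=> rR r_pr b8; apply: (@base_claimed q) => //; last by rewrite b8.
      exact: not3_neq.
    by apply: bonusP; rewrite ?b8.
  rewrite m21 muln1 in def_m; rewrite def_m (weight_prime p2R) in ws.
  have [col|ncol] := boolP (third_hit p2).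
    have b8 : bonus q p = 8 by apply: (bonus_p p p2) => //; rewrite ltnNge ltnW.
    have := received_bonus q pR; rewrite b8 ws (base_9 p) //; move: base_p2; clear; lia.
  have b8 : bonus q p2 = 8.
    by apply: (bonus_p p2 p) => //; [rewrite mulnC|rewrite lt_pp2].
  by have := received_bonus q p2R; rewrite b8 ws (base_9 p2) //; move: base_p; clear; lia.
have b17 : bonus q p = 17 by rewrite /bonus q2 def_s m1 muln1 !eqxx.
have := received_bonus q pR; rewrite b17 ws; by move: base_p; clear; lia.
Qed.
End Discharging.

Lemma cyclo3_gt0 q : 0 < cyclo3 q.
Proof. by rewrite /cyclo3 addn1. Qed.

Lemma logn_prod_cyclo3 r (S : seq nat) :
  logn r (\prod_(q <- S) cyclo3 q) = \sum_(q <- S) logn r (cyclo3 q).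
Proof.
elim: S => [|q S IH]; first by rewrite !big_nil logn1.
by rewrite !big_cons lognM ?cyclo3_gt0 ?prodn_gt0 // ?IH // => i; apply: cyclo3_gt0.
Qed.

(** * The balance for an odd perfect number *)

Section OddPerfect.

Variable N : nat.
Hypothesis N_odd : odd N.
Hypothesis N_perfect : perfect N.

Let N_gt0 : 0 < N. Proof. by case: (perfect_sigma N_perfect). Qed.

Definition square_prime (q : nat) : bool := (q != 3) && (logn q N == 2).

Definition square_primes : seq nat := [seq q <- primes N | square_prime q].

Notation S := square_primes.

Lemma mem_square_primes q : q \in S -> [/\ prime q, q %| N, odd q, q <> 3 & logn q N = 2].
Proof.
rewrite mem_filter mem_primes N_gt0 /= => /andP[/andP[/eqP q3 /eqP v2] /andP[q_pr qN]].
by split=> //; apply: dvdn_odd N_odd.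
Qed.

(** The product is an odd divisor of [sigma N = 2 * N]. *)
Lemma prod_cyclo3_dvd : \prod_(q <- S) cyclo3 q %| N.
Proof.
have prod_odd : odd (\prod_(q <- S) cyclo3 q).
  by elim/big_ind: _ => // [m n|q _]; [rewrite oddM => -> ->|apply: cyclo3_odd].
rewrite -(@Gauss_dvdr _ 2) ?coprimen2 //.
case: (perfect_sigma N_perfect) => _ <-.
rewrite (sigma_primes N_gt0) [X in _ %| X](bigID square_prime) /= dvdn_mulr //.
rewrite /square_primes big_filter big_seq_cond [X in _ %| X]big_seq_cond.
rewrite (eq_bigr (fun p => sigma (p ^ logn p N))) // => q /andP[].
rewrite mem_primes => /andP[q_pr _] /andP[_ /eqP ->].
by rewrite sigma_pfactor // !big_nat_recr //= big_geq // /cyclo3 expn0 expn1 -mulnn; lia.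
Qed.

Lemma cyclo3_dvd q : q \in S -> cyclo3 q %| N.
Proof.
by move=> qS; apply: dvdn_trans prod_cyclo3_dvd; rewrite (big_rem q) //= dvdn_mulr.
Qed.

Lemma count_le_logn r : \sum_(q <- S) logn r (cyclo3 q) <= logn r N.
Proof. by rewrite -logn_prod_cyclo3 dvdn_leq_log ?prod_cyclo3_dvd. Qed.

Notation B := (count (fun q => q %% 3 == 1) S).

Lemma count_1mod3_le : B <= logn 3 N.
Proof.
apply: leq_trans (count_le_logn 3); rewrite -sum1_count big_mkcond /=.
rewrite big_seq [X in _ <= X]big_seq leq_sum // => q /mem_square_primes[q_pr _ _ _ _].
case: eqP => // q1; have [m sm _] := cyclo3_1mod3 q1.
by rewrite logn_gt0 mem_primes cyclo3_gt0 sm dvdn_mulr.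
Qed.

Let S_good : {in S, forall q, [/\ prime q, odd q & q <> 3]}.
Proof. by move=> q /mem_square_primes[]. Qed.

Definition paid (r : nat) : nat :=
  \sum_(q <- S) (base S r * logn r (cyclo3 q) + bonus S q r).

Definition demand (r : nat) : nat :=
  if square_prime r then if r %% 3 == 1 then 21 else 25 else 0.

Lemma demand_le_paid :
  \sum_(r <- primes N) demand r <= \sum_(r <- primes N | r != 3) paid r.
Proof.
rewrite /demand -big_mkcond -big_filter -/S.
rewrite -[X in _ <= X]big_filter -/(not3_primes N) /paid exchange_big /=.
rewrite big_seq [X in _ <= X]big_seq leq_sum // => q qS.
rewrite -/(received S N q).
have [q1|q2] := S_mod3 S_good qS; rewrite ?q1 ?q2 /=.
  by apply: received_1mod3 => //; apply: cyclo3_dvd.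
by apply: received_2mod3 => //; apply: cyclo3_dvd.
Qed.

Lemma paid_le r : prime r -> r <> 3 ->
  paid r <= (if hit S r then 8 * logn r N + 17 else 9 * logn r N + 12).
Proof.
move=> r_pr r3; rewrite /paid big_split /= -big_distrr /=.
have S_uniq : uniq S by rewrite filter_uniq ?primes_uniq.
have := bonus_total S_good S_uniq r_pr r3.
have := count_le_logn r; rewrite /base; case: (hit S r); lia.
Qed.

Lemma paid0 r : prime r -> r %% 3 = 2 -> paid r = 0.
Proof.
move=> r_pr r2; rewrite /paid big_seq big1 // => q qS.
have r_sq : ~~ (r %| cyclo3 q).
  by apply/negP => /(dvd_cyclo3_mod3 r_pr)[r3|]; [rewrite r3 in r2|rewrite r2].
rewrite (_ : logn r (cyclo3 q) = 0) ?muln0; last first.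
  by apply/eqP; rewrite -leqn0 leqNgt logn_gt0 mem_primes (negPf r_sq) !andbF.
apply/eqP; rewrite -leqn0 leqNgt; apply: contra r_sq => b_gt0.
by apply: claim_dvd (bonusP S_good qS b_gt0).
Qed.

(** The term [37 * B], with [B] the number of primes of [S] that are 1 mod 3,
moves the surplus of the prime 3 to those primes.  A prime that is 2 mod 3
pays nothing, so [99 = 37 * 2 + 25] is exact for it when its exponent is 2. *)
Lemma local_balance r : r \in primes N ->
  99 + (if r != 3 then paid r else 0) + (r == 3) * (37 * B)
  <= 37 * logn r N + demand r + 37 * (square_prime r && (r %% 3 == 1))
     + 88 * odd (logn r N) + 99 * (r == 3).
Proof.
move=> rN; have v_gt0 : 0 < logn r N by rewrite logn_gt0.
have r_pr : prime r by move: rN; rewrite mem_primes => /andP[].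
have [->|/eqP r3] /= := eqVneq r 3; first by have := count_1mod3_le; lia.
have := paid_le r_pr r3.
rewrite /demand; have [/andP[_ /eqP v2]|] := boolP (square_prime r).
  have [r1|/eqP r1] := eqVneq (r %% 3) 1; first by rewrite v2; case: ifP; lia.
  have r2 : r %% 3 = 2.
    have : ~~ (3 %| r) by rewrite dvdn_prime2 //; apply/eqP => e; apply: r3.
    by rewrite /dvdn; lia.
  by rewrite paid0 // v2.
rewrite /square_prime (introN eqP r3) /= => nv2.
by case: ifP => _; have [o|e] := boolP (odd (logn r N)); lia.
Qed.

Lemma sum_odd_exponent : \sum_(r <- primes N) (odd (logn r N) : nat) <= 1.
Proof.
rewrite -big_mkcond /= -big_filter sum1_size.
have : {in [seq r <- primes N | odd (logn r N)] &, forall p q, p = q}.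
  move=> p q; rewrite !mem_filter => /andP[p_odd pN] /andP[q_odd qN].
  exact: odd_exponent_unique pN qN _ _.
have : uniq [seq r <- primes N | odd (logn r N)] by rewrite filter_uniq ?primes_uniq.
case: [seq _ <- _ | _] => [|p [|q F]] //= /andP[] /[swap] _ /negP pF.
by move/(_ p q); rewrite !inE !eqxx orbT => /(_ isT isT) e; case: pF; rewrite e mem_head.
Qed.

Lemma omega_balance : 99 * little_omega N <= 37 * big_omega N + 187.
Proof.
have := @leq_sum _ (primes N) (fun r => r \in primes N) _ _ local_balance.
rewrite -!big_seq 6!big_split /= -!big_distrr -big_distrl /=.
rewrite big_const_seq count_predT iter_addn_0 -/(little_omega N).
rewrite -big_mkcond /= -/(big_omega N).
have -> : \sum_(r <- primes N) (square_prime r && (r %% 3 == 1) : nat) = B.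
  rewrite -sum1_count big_filter_cond [RHS]big_mkcond /=.
  by apply: eq_bigr => r _; case: (_ && _).
have -> : \sum_(r <- primes N) (r == 3 : nat) = (3 \in primes N).
  by rewrite -big_mkcond /= sum1_count count_uniq_mem ?primes_uniq.
have := demand_le_paid; have := sum_odd_exponent; have := count_1mod3_le.
have : (3 \in primes N) = (0 < logn 3 N) by rewrite logn_gt0.
by case: (3 \in primes N) => /=; lia.
Qed.

End OddPerfect.

Import Order.TTheory GRing.Theory Num.Theory.
Local Open Scope ring_scope.

Theorem theorem1p3 (N : nat) (hodd : odd N) (hperf : perfect N) :
  (99 / 37 * (little_omega N)%:R - 187 / 37 <= (big_omega N)%:R :> rat).
Proof.
have := omega_balance hodd hperf.
rewrite -(ler_nat rat) natrD !natrM; lra.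
Qed.
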